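(* Let $\{A,B,C\}\subset S^{1,1}$ be a non-degenerate contractible spatiolateral de Sitter triangle with polar triangle $\{A',B',C'\}$ such that the side $a'$ of the polar triangle (between $B'$ and $C'$) is not strange, i.e. $B'$ and $C'$ both lie in $H^2$ or both lie in $-H^2$. Let $a,b,c$ be the side lengths opposite $A,B,C$ and $\alpha,\beta,\gamma$ the angles at $A,B,C$. Then $$\cosh(\alpha)=\cosh(\beta)\cosh(\gamma)+\cos(a)\sinh(\beta)\sinh(\gamma),$$ $$\cosh(\beta)=\cosh(\alpha)\cosh(\gamma)-\cos(b)\sinh(\alpha)\sinh(\gamma),$$ $$\cosh(\gamma)=\cosh(\alpha)\cosh(\beta)-\cos(c)\sinh(\alpha)\sinh(\beta).$$
   Context: On $\mathbb{R}^3$ let $\langle\langle x,y\rangle\rangle=-x_1y_1+x_2y_2+x_3y_3$, $|||x|||=\sqrt{|\langle\langle x,x\rangle\rangle|}$, and let $\times$ be the Euclidean cross product. $S^{1,1}=\{x:\langle\langle x,x\rangle\rangle=1\}$, $H^2=\{x:\langle\langle x,x\rangle\rangle=-1,\ x_1>0\}$, $-H^2=\{-x:x\in H^2\}$. A two-dimensional linear subspace is spacelike if $\langle\langle\cdot,\cdot\rangle\rangle$ restricted to it is positive definite. For $A,B\in S^{1,1}$ with $A\ne\pm B$, the side between $A$ and $B$ is spacelike if $\operatorname{span}(A,B)$ is spacelike (equivalently $|\langle\langle A,B\rangle\rangle|<1$); its length is then $\arccos(\langle\langle A,B\rangle\rangle)\in(0,\pi)$, and the unit tangent vector at $A$ towards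 $B$ is $X_{AB}=\dfrac{B-\langle\langle A,B\rangle\rangle A}{|||A\times B|||}$. A spatiolateral triangle is a set of three distinct points $\{A,B,C\}\subset S^{1,1}$ all of whose sides are spacelike; it is non-degenerate if $A,B,C$ are linearly independent. It is contractible if, after projecting the vertices to the $(x_2,x_3)$-plane, there is a line through the origin such that all three projected points lie on one side of the line. Side lengths: $a$ between $B$ and $C$, $b$ between $A$ and $C$, $c$ between $A$ and $B$. The angle at $A$ is $\alpha=\operatorname{arcosh}(|\langle\langle X_{AB},X_{AC}\rangle\rangle|)\ge 0$, and analogously $\beta$ at $B$, $\gamma$ at $C$. The polar triangle $\{A',B',C'\}$ is given by $A'=\epsilon\frac{B\times C}{|||B\times C|||}$, $B'=\epsilon\frac{C\times A}{|||C\times A|||}$, $C'=\epsilon\frac{A\times B}{|||A\times B|||}$ with $\epsilon=\operatorname{sign}\det(A,B,C)$. The polar triangle of a non-degenerate spatiolateral triangle is contained in $H^2\cup(-H^2)$. *)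

(* Defs.v *)
From HB Require Import structures.
From mathcomp Require Import all_boot all_order all_algebra.
From mathcomp Require Import all_classical all_reals all_analysis.

Set Implicit Arguments.
Unset Strict Implicit.
Unset Printing Implicit Defensive.

Import Order.TTheory GRing.Theory Num.Theory.
Import numFieldNormedType.Exports.

Local Open Scope classical_set_scope.
Local Open Scope ring_scope.

Section Hyperbolic.
Context {R : realType}.

Definition cosh (x : R) : R := (expR x + expR (- x)) / 2.
Definition sinh (x : R) : R := (expR x - expR (- x)) / 2.

(* Inverse of cosh on [0, +oo[, in the style of acos; meaningful for y >= 1. *)
Definition arcosh (y : R) : R := get [set t | 0 <= t /\ cosh t = y].

End Hyperbolic.

(* The coordinates x_1, x_2, x_3 are x 0 0, x 0 1, x 0 2. *)
Section DeSitter.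
Context {R : realType}.
Local Notation V := 'rV[R]_3.
Implicit Types (x y A B C : V).

Definition ldot x y : R :=
  - (x 0 0 * y 0 0) + x 0 1 * y 0 1 + x 0 2 * y 0 2.

Definition lnorm x : R := Num.sqrt `|ldot x x|.

(* The Euclidean cross product, not its Lorentzian variant. *)
Definition cross x y : V :=
  \row_i [:: x 0 1 * y 0 2 - x 0 2 * y 0 1;
             x 0 2 * y 0 0 - x 0 0 * y 0 2;
             x 0 0 * y 0 1 - x 0 1 * y 0 0]`_i.

Definition det3 A B C : R := \det (\matrix_(i < 3) [:: A; B; C]`_i).

Definition S11 : set V := [set x | ldot x x = 1].
Definition H2 : set V := [set x | ldot x x = -1 /\ 0 < x 0 0].
Definition oppH2 : set V := [set - x | x in H2].

Definition spacelike_plane (U : {vspace V}) : Prop :=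
  \dim U = 2%N /\ forall v : V, v \in U -> v != 0 -> 0 < ldot v v.

Definition spacelike_side A B : Prop :=
  [/\ A <> B, A <> - B & spacelike_plane <<[:: A; B]>>%VS].

Definition spatiolateral_triangle A B C : Prop :=
  [/\ S11 A /\ S11 B /\ S11 C,
      A <> B /\ B <> C /\ A <> C
    & spacelike_side A B /\ spacelike_side B C /\ spacelike_side A C].

Definition nondegenerate_triangle A B C : Prop := free [:: A; B; C].

(* Drops the coordinate x_1. *)
Definition proj23 x : 'rV[R]_2 := col' 0 x.

(* The line is the orthogonal of the normal vector n, and the three projected
   points lie in the same open half-plane.  For spatiolateral triangles, closed
   half-planes would give the same notion: sides between points whose
   projections lie on opposite rays are never spacelike. *)
Definition contractible_triangle A B C : Prop :=
  exists2 n : 'rV[R]_2, n != 0 &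
    forall x : V, x \in [:: A; B; C] -> 0 < (proj23 x *m n^T) 0 0.

Definition side_length A B : R := acos (ldot A B).

(* The unit tangent vector at A towards B. *)
Definition tangent A B : V := (lnorm (cross A B))^-1 *: (B - ldot A B *: A).

(* The angle at A. *)
Definition angle A B C : R := arcosh `|ldot (tangent A B) (tangent A C)|.

Definition unit_cross x y : V := (lnorm (cross x y))^-1 *: cross x y.

Definition polarA A B C : V := Num.sg (det3 A B C) *: unit_cross B C.
Definition polarB A B C : V := Num.sg (det3 A B C) *: unit_cross C A.
Definition polarC A B C : V := Num.sg (det3 A B C) *: unit_cross A B.

(* The side between two points of the union of H2 and oppH2. *)
Definition not_strange x y : Prop := (H2 x /\ H2 y) \/ (oppH2 x /\ oppH2 y).

End DeSitter.

(* Main.v *)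
(* Write p, q, r for the products <<B,C>>, <<A,C>>, <<A,B>>.  By the Lorentzian
   Lagrange identity, cosh alpha = |p - q r| / sqrt ((1 - q^2) (1 - r^2)) and
   sinh alpha = |det (A, B, C)| / sqrt ((1 - q^2) (1 - r^2)), and similarly for
   beta and gamma, so the three laws are rational identities as soon as the signs
   of p - q r, q - p r and r - p q are known.  These are the signs of the products
   of the timelike vectors B x C, C x A, A x B, hence are decided by the signs of
   their first coordinates.  If a, b, c are the projections of A, B, C to the
   (x_2, x_3)-plane, these coordinates are the brackets [b,c], [c,a], [a,b], and
   [b,c] a + [c,a] b + [a,b] c = 0.  Contractibility forbids the three brackets to
   have the same sign; as B' and C' lie on the same sheet, [b,c] is the odd one. *)
Require Import Defs.
From mathcomp Require Import all_boot all_order all_algebra.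
From mathcomp Require Import all_classical all_reals all_analysis.
From mathcomp Require Import ring lra.

Import Order.TTheory GRing.Theory Num.Theory.
Local Open Scope ring_scope.

(** * Hyperbolic functions and the inverse [arcosh] *)

Section Hyperbolic.
Set Implicit Arguments.
Unset Strict Implicit.
Context {R : realType}.
Implicit Types x y : R.

Lemma cosh2_sinh2 x : cosh x ^+ 2 - sinh x ^+ 2 = 1.
Proof.
have := expRxMexpNx_1 x; rewrite /cosh /sinh => e.
by field: e.
Qed.

Lemma sinh_ge0 x : 0 <= x -> 0 <= sinh x.
Proof.
move=> x0; rewrite /sinh divr_ge0// subr_ge0 ler_expR; lra.
Qed.

Lemma arcosh_spec y : 1 <= y -> 0 <= arcosh y /\ cosh (arcosh y) = y.
Proof.
move=> y1; rewrite /arcosh.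
have y2 : 0 <= y ^+ 2 - 1 by rewrite subr_ge0 exprn_ege1.
set s := Num.sqrt (y ^+ 2 - 1).
have s0 : 0 <= s by exact: sqrtr_ge0.
have ss : s ^+ 2 = y ^+ 2 - 1 by exact: sqr_sqrtr.
have ys0 : 0 < y + s by lra.
have getP := @getPex _ [set t | 0 <= t /\ cosh t = y]%classic.
(* [get] meets its specification once the set is inhabited. The witness solves a quadratic equation
   in [expR t], whose two roots [y + s] and [y - s] are mutually inverse. *)
apply: getP; exists (ln (y + s)); split.
  by apply: ln_ge0; lra.
rewrite /cosh expRN lnK//.
have -> : (y + s)^-1 = y - s.
  by apply: (mulfI (lt0r_neq0 ys0)); rewrite mulfV ?gt_eqF//; ring: ss.
by field.
Qed.

Lemma sinh_arcosh y : 1 <= y -> sinh (arcosh y) = Num.sqrt (y ^+ 2 - 1).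
Proof.
move=> /arcosh_spec[t0 ct].
rewrite -{2}ct -(cosh2_sinh2 (arcosh y)) opprB addrC subrK sqrtr_sqr.
by rewrite ger0_norm// sinh_ge0.
Qed.

End Hyperbolic.

(** Multiplying the relation by [y] gives [x * y * a = - (y ^+ 2 * b + y * z * c) < 0]; multiplying
    by [z] settles the other sign. *)
Lemma bracket_sign (R : realDomainType) (x y z a b c : R) :
  0 < a -> 0 < b -> 0 < c -> x * a + y * b + z * c = 0 -> 0 < y * z ->
  x * y < 0 /\ x * z < 0.
Proof.
move=> a0 b0 c0 e yz.
have yzb := mulr_gt0 yz b0; have yzc := mulr_gt0 yz c0.
split; rewrite -(pmulr_llt0 _ a0).
- have : y * (x * a + y * b + z * c) = 0 by rewrite e mulr0.
  have := mulr_ge0 (sqr_ge0 y) (ltW b0); lra.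
- have : z * (x * a + y * b + z * c) = 0 by rewrite e mulr0.
  have := mulr_ge0 (sqr_ge0 z) (ltW c0); lra.
Qed.

(** * Lorentzian products, timelike vectors and spacelike sides *)

Section DeSitter.
Set Implicit Arguments.
Unset Strict Implicit.
Context {R : realType}.
Implicit Types A B C x y z w : 'rV[R]_3.

Lemma ldotC x y : ldot x y = ldot y x.
Proof. by rewrite /ldot; ring. Qed.

Lemma ldotBZ x y z w (k l : R) : ldot (x - k *: y) (z - l *: w) =
  ldot x z - l * ldot x w - k * ldot y z + k * l * ldot y w.
Proof. by rewrite /ldot !mxE; ring. Qed.

Lemma ldotZ x y (k l : R) : ldot (k *: x) (l *: y) = k * l * ldot x y.
Proof. by rewrite /ldot !mxE; ring. Qed.

Lemma ldotN x y : ldot x (- y) = - ldot x y.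
Proof. by rewrite /ldot !mxE; ring. Qed.

Lemma ldot_cross x y z w :
  ldot (cross x y) (cross z w) = ldot x w * ldot y z - ldot x z * ldot y w.
Proof. by rewrite /ldot /cross !mxE /=; ring. Qed.

(** The spatial part of a timelike vector is shorter than its time coordinate. By Cauchy-Schwarz in
    the plane, the time term then dominates the product and fixes its sign. *)
Lemma ldot_timelike_gt0 x y : ldot x x < 0 -> ldot y y < 0 ->
  x 0 0 * y 0 0 < 0 -> 0 < ldot x y.
Proof.
rewrite /ldot.
move: (x 0 0) (x 0 1) (x 0 2) (y 0 0) (y 0 1) (y 0 2).
move=> x0 x1 x2 y0 y1 y2 hx hy hxy.
have cs : (x1 * y1 + x2 * y2) ^+ 2 < (x0 * y0) ^+ 2.
  have -> : (x1 * y1 + x2 * y2) ^+ 2 = (x1 ^+ 2 + x2 ^+ 2) * (y1 ^+ 2 + y2 ^+ 2)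
      - (x1 * y2 - x2 * y1) ^+ 2 by ring.
  have := sqr_ge0 (x1 * y2 - x2 * y1).
  have : (x1 ^+ 2 + x2 ^+ 2) * (y1 ^+ 2 + y2 ^+ 2) < x0 ^+ 2 * y0 ^+ 2.
    by apply: ltr_pM; rewrite ?addr_ge0 ?sqr_ge0//; rewrite !expr2; lra.
  rewrite -exprMn; lra.
have xy2 : 0 < (x0 * y0) ^+ 2 by rewrite exprn_even_gt0 //= lt_eqF.
rewrite -ltr_sqrt// in cs.
rewrite !sqrtr_sqr (ltr0_norm hxy) in cs.
by have := ler_norm (- (x1 * y1 + x2 * y2)); rewrite normrN; lra.
Qed.

Lemma ldot_timelike_lt0 x y : ldot x x < 0 -> ldot y y < 0 ->
  0 < x 0 0 * y 0 0 -> ldot x y < 0.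
Proof.
move=> hx hy hxy.
rewrite -oppr_gt0 -ldotN; apply: ldot_timelike_gt0 => //.
  by rewrite ldotN ldotC ldotN opprK.
by rewrite mxE mulrN oppr_lt0.
Qed.

(** This is the square of the component of [B] orthogonal to [A], a vector of the spacelike plane
    that vanishes only if [B] is [A] or [- A]. *)
Lemma spacelike_side_ldot A B : S11 A -> S11 B -> spacelike_side A B ->
  0 < 1 - ldot A B ^+ 2.
Proof.
move=> hA hB [nAB nANB [_ pos]].
have e : ldot (B - ldot A B *: A) (B - ldot A B *: A) = 1 - ldot A B ^+ 2.
  by rewrite ldotBZ hA hB (ldotC B A); ring.
rewrite -e; apply: pos.
  by rewrite rpredB ?rpredZ// memv_span// !inE eqxx ?orbT.
apply/negP => /eqP v0; move: e; rewrite v0 => e.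
have /eqP : ldot A B ^+ 2 = 1.
  by apply/eqP; rewrite eq_sym -subr_eq0 -e /ldot !mxE; apply/eqP; ring.
rewrite sqrf_eq1 => /orP[] /eqP r1; move/eqP: v0; rewrite subr_eq0 r1 => /eqP.
  by rewrite scale1r => h; apply: nAB.
by rewrite scaleN1r => h; apply: nANB; rewrite h opprK.
Qed.

Lemma spacelike_side_sym A B : spacelike_side A B -> spacelike_side B A.
Proof.
case=> nAB nANB AB; split; first by move=> h; apply: nAB.
  by move=> h; apply: nANB; rewrite h opprK.
have -> // : <<[:: B; A]>>%VS = <<[:: A; B]>>%VS.
by rewrite !span_cons span_nil !addv0 addvC.
Qed.

Lemma cross_timelike A B : S11 A -> S11 B -> spacelike_side A B ->
  ldot (cross A B) (cross A B) < 0.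
Proof.
move=> hA hB /(spacelike_side_ldot hA hB).
by rewrite ldot_cross hA hB (ldotC B A); lra.
Qed.

(** * Side lengths and angles in terms of Lorentzian products *)

Lemma cos_side_length A B : S11 A -> S11 B -> spacelike_side A B ->
  cos (side_length A B) = ldot A B.
Proof.
move=> hA hB /(spacelike_side_ldot hA hB) h; apply: acosK.
by rewrite in_itv /=; apply/andP; split; nra.
Qed.

(** On [S11], minus the determinant of the Gram matrix; being symmetric in the vertices, it serves
    all three angles. *)
Definition gram A B C : R := ldot A B ^+ 2 + ldot A C ^+ 2 + ldot B C ^+ 2
  - 2 * ldot A B * ldot A C * ldot B C - 1.

Lemma gram_ge0 A B C : S11 A -> S11 B -> S11 C -> 0 <= gram A B C.
Proof.
move=> hA hB hC.
(* minus the Gram determinant is the square of det (A, B, C) *)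
have -> : gram A B C = (A 0 0 * cross B C 0 0 + A 0 1 * cross B C 0 1
    + A 0 2 * cross B C 0 2) ^+ 2.
  (* Inserting the factors [ldot A A], [ldot B B], [ldot C C], all equal to 1, turns the claim into
     an unconditional polynomial identity in the coordinates. *)
  transitivity (ldot A B ^+ 2 * ldot C C + ldot A C ^+ 2 * ldot B B
    + ldot B C ^+ 2 * ldot A A - 2 * ldot A B * ldot A C * ldot B C
    - ldot A A * ldot B B * ldot C C).
    by rewrite hA hB hC /gram; ring.
  by rewrite /ldot !mxE /=; ring.
exact: sqr_ge0.
Qed.

Definition side_sin A B : R := Num.sqrt (1 - ldot A B ^+ 2).

Lemma lnorm_cross A B : S11 A -> S11 B -> spacelike_side A B ->
  lnorm (cross A B) = side_sin A B.
Proof.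
move=> hA hB /(spacelike_side_ldot hA hB) r1.
rewrite /lnorm ldot_cross hA hB (ldotC B A) mul1r -expr2.
by rewrite -normrN opprB ger0_norm// ltW.
Qed.

Lemma cosh_sinh_angle A B C : S11 A -> S11 B -> S11 C ->
    spacelike_side A B -> spacelike_side A C ->
  cosh (angle A B C) =
    `|ldot B C - ldot A B * ldot A C| / (side_sin A B * side_sin A C) /\
  sinh (angle A B C) =
    Num.sqrt (gram A B C) / (side_sin A B * side_sin A C).
Proof.
move=> hA hB hC sAB sAC.
have r1 := spacelike_side_ldot hA hB sAB.
have q1 := spacelike_side_ldot hA hC sAC.
have g0 := gram_ge0 hA hB hC.
rewrite /angle /tangent !lnorm_cross// ldotZ ldotBZ hA (ldotC B A).
set S := side_sin A B * side_sin A C.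
have S0 : 0 < S by rewrite mulr_gt0// sqrtr_gt0.
have SS : S ^+ 2 = (1 - ldot A B ^+ 2) * (1 - ldot A C ^+ 2).
  by rewrite exprMn !sqr_sqrtr// ltW.
have -> : ldot B C - ldot A C * ldot A B - ldot A B * ldot A C
    + ldot A B * ldot A C * 1 = ldot B C - ldot A B * ldot A C by ring.
rewrite -invfM -/S mulrC normrM normfV (gtr0_norm S0).
set u := `|_|.
(* This both puts [u / S] in the range where [arcosh] is meaningful and yields the numerator of
   [sinh]. *)
have uu : u ^+ 2 - S ^+ 2 = gram A B C.
  by rewrite SS /u real_normK ?num_real// /gram; ring.
have y1 : 1 <= u / S.
  by rewrite ler_pdivlMr// mul1r -ler_sqr ?nnegrE ?(ltW S0) ?normr_ge0// -subr_ge0 uu.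
split; first by case: (arcosh_spec y1).
have yy : (u / S) ^+ 2 - 1 = gram A B C * S ^- 2.
  by rewrite -uu; field; rewrite gt_eqF.
by rewrite sinh_arcosh// yy sqrtrM// sqrtrV ?sqr_ge0// sqrtr_sqr gtr0_norm.
Qed.

(** * Signs of the first coordinates of the cross products *)

Lemma not_strange_time x y : not_strange x y -> 0 < x 0 0 * y 0 0.
Proof.
case=> [[[_ x0] [_ y0]]|[[x' [_ x0] <-] [y' [_ y0] <-]]]; first exact: mulr_gt0.
by rewrite !mxE mulrNN mulr_gt0.
Qed.

(** The orientation sign enters squared and the norms are nonnegative, so the normalization cannot
    change the sign of the product. *)
Lemma not_strange_polar_time A B C : not_strange (polarB A B C) (polarC A B C) ->
  0 < cross C A 0 0 * cross A B 0 0.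
Proof.
move=> /not_strange_time; rewrite /polarB /polarC /unit_cross.
move: (cross C A) (cross A B) (Num.sg _) => Y Z s; rewrite !mxE => h.
have k0 : 0 <= s ^+ 2 * ((lnorm Y)^-1 * (lnorm Z)^-1).
  by rewrite mulr_ge0 ?sqr_ge0// mulr_ge0// invr_ge0 sqrtr_ge0.
rewrite ltNge; apply/negP => YZ.
have := mulr_ge0_le0 k0 YZ; rewrite leNgt => /negP; apply.
by apply: (lt_le_trans h); rewrite le_eqVlt; apply/orP; left; apply/eqP; ring.
Qed.

(** The positive weights are the values at the vertices of the linear form with normal [n], applied
    to the planar bracket relation. *)
Lemma contractible_bracket A B C : contractible_triangle A B C ->
  exists a b c : R, [/\ 0 < a, 0 < b, 0 < c &
    cross B C 0 0 * a + cross C A 0 0 * b + cross A B 0 0 * c = 0].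
Proof.
case=> n _ hn.
have e x : (proj23 x *m n^T) 0 0 = x 0 1 * n 0 0 + x 0 2 * n 0 1.
  rewrite mxE !big_ord_recl big_ord0 addr0 !mxE.
  by congr (x _ _ * n _ _ + x _ _ * n _ _); apply: val_inj.
exists (A 0 1 * n 0 0 + A 0 2 * n 0 1), (B 0 1 * n 0 0 + B 0 2 * n 0 1),
  (C 0 1 * n 0 0 + C 0 2 * n 0 1).
split; last by rewrite !mxE /=; ring.
- by rewrite -e hn// !inE eqxx.
- by rewrite -e hn// !inE eqxx orbT.
- by rewrite -e hn// !inE eqxx !orbT.
Qed.

End DeSitter.

Theorem theorem5p8 (R : realType) (A B C : 'rV[R]_3)
  (tri : spatiolateral_triangle A B C)
  (nondeg : nondegenerate_triangle A B C)
  (contr : contractible_triangle A B C)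
  (nstrange : not_strange (polarB A B C) (polarC A B C)) :
  let a := side_length B C in
  let b := side_length A C in
  let c := side_length A B in
  let alpha := angle A B C in
  let beta := angle B A C in
  let gamma := angle C A B in
  [/\ cosh alpha = cosh beta * cosh gamma + cos a * sinh beta * sinh gamma,
      cosh beta = cosh alpha * cosh gamma - cos b * sinh alpha * sinh gamma
    & cosh gamma = cosh alpha * cosh beta - cos c * sinh alpha * sinh beta].
Proof.
move=> a b c alpha beta gamma.
case: tri => [[hA [hB hC]] _ [sAB [sBC sAC]]].
have r1 := spacelike_side_ldot hA hB sAB.
have q1 := spacelike_side_ldot hA hC sAC.
have p1 := spacelike_side_ldot hB hC sBC.
have [ca sa] := cosh_sinh_angle hA hB hC sAB sAC.
have [cb sb] := cosh_sinh_angle hB hA hC (spacelike_side_sym sAB) sBC.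
have [cc sc] :=
  cosh_sinh_angle hC hA hB (spacelike_side_sym sAC) (spacelike_side_sym sBC).
have YZ := not_strange_polar_time nstrange.
have [na [nb [nc [na0 nb0 nc0 e0]]]] := contractible_bracket contr.
have tX := cross_timelike hB hC sBC.
have tY := cross_timelike hC hA (spacelike_side_sym sAC).
have tZ := cross_timelike hA hB sAB.
have [XY XZ] := bracket_sign na0 nb0 nc0 e0 YZ.
have u0 := ldot_timelike_lt0 tY tZ YZ.
have v0 := ldot_timelike_gt0 tX tZ XZ.
have w0 := ldot_timelike_gt0 tX tY XY.
rewrite !ldot_cross hA hB hC in u0 v0 w0.
rewrite /a /b /c !cos_side_length// {}ca {}sa {}cb {}sb {}cc {}sc.
have -> : gram B A C = gram A B C by rewrite /gram (ldotC B A); ring.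
have -> : gram C A B = gram A B C by rewrite /gram (ldotC C A) (ldotC C B); ring.
have g0 := gram_ge0 hA hB hC.
rewrite /side_sin.
rewrite !(ldotC B A, ldotC C A, ldotC C B) in u0 v0 w0 *.
have {g0} : Num.sqrt (gram A B C) ^+ 2 = gram A B C by exact: sqr_sqrtr.
rewrite /gram.
move: (Num.sqrt (_ - 1)) => D.
move: (ldot A B) (ldot A C) (ldot B C) r1 q1 p1 u0 v0 w0.
move=> r q p r1 q1 p1 u0 v0 w0 DD.
(* Only [p - r * q] is negative, whence the different sign of the [cos a] term. *)
rewrite (@ltr0_norm _ (p - r * q)) ?(@gtr0_norm _ (q - r * p))
  ?(@gtr0_norm _ (r - q * p)); try lra.
have := sqr_sqrtr (ltW r1); have := sqr_sqrtr (ltW q1).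
have := sqr_sqrtr (ltW p1).
move: r1 q1 p1; rewrite -(sqrtr_gt0 (1 - r ^+ 2)) -(sqrtr_gt0 (1 - q ^+ 2)).
rewrite -(sqrtr_gt0 (1 - p ^+ 2)).
move: (Num.sqrt (1 - r ^+ 2)) (Num.sqrt (1 - q ^+ 2)) (Num.sqrt (1 - p ^+ 2)).
move=> s3 s2 s1 s30 s20 s10 e1 e2 e3.
have [n1 n2 n3] : [/\ s1 != 0, s2 != 0 & s3 != 0] by rewrite !gt_eqF.
(* Each product of two [sinh] contributes [D ^+ 2], so every square root that remains in a numerator
   is squared and can be eliminated. *)
by split; field: e1 e2 e3 DD; rewrite n1 n2 n3.
Qed.
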